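(* Let $k\ge 2$ and let $V\subseteq\mathbb{R}^k$ be a totally irrational subspace of dimension $d=k-1$. Then there is a constant $K_V>0$, depending on $V$ but on no other parameters, such that for every $x\in\mathbb{R}^k$ and every window $\mathcal{S}$ which is a special interval for $V$, there exist a lattice $\Lambda$ in $V\cong\mathbb{R}^{d}$ and a bijection $f:Y_{\mathcal{S},x}\to\Lambda$ satisfying \[\sup_{y\in Y_{\mathcal{S},x}}|f(y)-y|\le K_V|\mathcal{S}|^{-1}.\]
   Context: Cut-and-project sets. Let $\pi:\mathbb{R}^k\to\mathbb{R}^k/\mathbb{Z}^k$ be the canonical projection. A subspace $V$ is totally irrational if $\pi(V)$ is dense in $\mathbb{R}^k/\mathbb{Z}^k$. For $\mathcal{S}\subseteq\mathbb{R}^k/\mathbb{Z}^k$ (the window, or section) and $x\in\mathbb{R}^k$, put \[Y_{\mathcal{S},x}=\{v\in V:\pi(v+x)\in\mathcal{S}\}.\] Coordinates. With $\dim V=k-1$, the coordinates of $\mathbb{R}^k$ are ordered so that the $k$-th standard basis vector $e_k$ is not in $V$; then $V=\{(y_1,\ldots,y_{k-1},\sum_{i=1}^{k-1}y_i\alpha_i):y_i\in\mathbb{R}\}$ for unique $\alpha_1,\ldots,\alpha_{k-1}\in\mathbb{R}$. Total irrationality implies that at least one $\alpha_i$ is irrational, and the coordinates are ordered so that $\alpha_1$ is irrational. This ordering is fixed as part of the data of $V$. Windows are taken in the image of the line spanned by $e_k$: a set $\mathcal{I}\subseteq\mathbb{R}/\mathbb{Z}$ is identified with the window $\mathcal{S}=\{\pi(te_k):t\in\mathbb{R},\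 t\bmod 1\in\mathcal{I}\}$, and $|\mathcal{S}|$ denotes the total length (Lebesgue measure) of $\mathcal{I}$. ''$\mathcal{S}$ is a special interval for $V$'' means that the corresponding $\mathcal{I}$ is a special interval for $\alpha=\{\alpha_1\}$ (the fractional part of $\alpha_1$), as defined next. Special intervals. Let $\alpha\in(0,1)$ be irrational with simple continued fraction $\alpha=[0;a_1,a_2,\ldots]$ and let $q_k$ ($k\ge0$) be the denominators of its convergents in lowest terms ($q_0=1$, $q_1=a_1$, $q_{k+1}=a_{k+1}q_k+q_{k-1}$). Every non-negative integer $n$ has a unique Ostrowski expansion $n=\sum_{k=0}^\infty c_{k+1}q_k$ with integers $c_{k+1}$, only finitely many nonzero, such that $0\le c_1<a_1$, $0\le c_{k+1}\le a_{k+1}$ for $k\ge1$, and $c_k=0$ whenever $c_{k+1}=a_{k+1}$ for some $k\ge1$. For an integer $m\ge1$ let $\mathcal{A}(m)$ be the set of integers $n\ge0$ whose Ostrowski expansion has the form $n=\sum_{k=m}^\infty c_{k+1}q_k$ (so $0\in\mathcal{A}(m)$). For $\gamma\in\mathbb{R}/\mathbb{Z}$ put $\mathcal{J}(m,\gamma)=\gamma+\overline{\{n\alpha:n\in\mathcal{A}(m)\}}\subseteq\mathbb{R}/\mathbb{Z}$ (closure in $\mathbb{R}/\mathbb{Z}$). The sets $\mathcal{J}(m,\gamma)$, which are intervals in $\mathbb{R}/\mathbb{Z}$, are the special intervals for $\alpha$. *)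

(* Defs.v *)
From HB Require Import structures.
From mathcomp Require Export all_boot all_order all_algebra.
From mathcomp Require Export all_classical all_reals all_analysis.
From mathcomp Require Export generic_quotient ring_quotient.
Export Order.TTheory GRing.Theory Num.Theory.
Export numFieldNormedType.Exports.

Set Implicit Arguments.
Unset Strict Implicit.
Unset Printing Implicit Defensive.

Local Open Scope classical_set_scope.
Local Open Scope ring_scope.
Local Open Scope quotient_scope.

(* The quotients below carry the group structure of [ring_quotient]; where a   *)
(* topology is needed they are read through the convertible alias              *)
(* [quotient_topology], which carries the quotient topology.                   *)

Section Integers.
Variables (R : realType) (k : nat).

Definition int_number : {pred R} := fun t => t \is a Num.int.

Fact int_number_zmod_closed : zmod_closed int_number.
Proof. by split=> [|s t sZ tZ]; [exact: rpred0 | exact: rpredB]. Qed.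
HB.instance Definition _ :=
  GRing.isZmodClosed.Build R int_number int_number_zmod_closed.

Definition int_vector : {pred 'rV[R]_k} := fun v => v \is a mxOver Num.int.

Fact int_vector_zmod_closed : zmod_closed int_vector.
Proof.
split=> [|u v /mxOverP uZ /mxOverP vZ]; apply/mxOverP=> i j; rewrite !mxE.
  exact: rpred0.
exact: rpredB.
Qed.
HB.instance Definition _ :=
  GRing.isZmodClosed.Build 'rV[R]_k int_vector int_vector_zmod_closed.

End Integers.

Notation circle R := (Quotient.quot (@int_number R)).

Notation torus R k := (Quotient.quot (@int_vector R k)).

Section CutAndProject.
Context {R : realType}.
Implicit Types (x alpha : R) (I : set (circle R)).

Definition frac_part x : R := x - (Num.floor x)%:~R.

Section Ambient.
Context {k : nat}.
Implicit Types (v : 'rV[R]_k) (V : {vspace 'rV[R]_k}).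

(* The library norm on matrices is the sup norm, hence this definition. *)
Definition euclidean_norm v : R := Num.sqrt (\sum_(i < k) v 0 i ^+ 2).

Definition totally_irrational V :=
  dense ([set \pi_(torus R k) v | v in [set` V]]
         : set (quotient_topology (torus R k))).

Definition cut_and_project V (S : set (torus R k)) (x : 'rV[R]_k)
    : set 'rV[R]_k :=
  [set v | v \in V /\ S (\pi_(torus R k) (v + x))].

(* The Z-span of an R-basis of V. *)
Definition is_lattice V (L : set 'rV[R]_k) :=
  exists2 b : (\dim V).-tuple 'rV[R]_k, basis_of V b &
    L = range (fun c : 'I_(\dim V) -> int =>
                 \sum_(i < \dim V) (c i)%:~R *: tnth b i).

End Ambient.

Section Coordinates.
Context {d : nat}.

Definition last_basis_vector : 'rV[R]_d.+1 := delta_mx 0 ord_max.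

(* V = {(y_1, ..., y_d, \sum_i y_i * a_i)}; [lift ord_max] is the inclusion of *)
(* the first d indices.                                                        *)
Definition slopes (V : {vspace 'rV[R]_d.+1}) (a : 'I_d -> R) :=
  [set` V] = [set v : 'rV[R]_d.+1 | v 0 ord_max =
    \sum_(i < d) v 0 (lift ord_max i) * a i].

Definition line_window I : set (torus R d.+1) :=
  [set \pi_(torus R d.+1) (t *: last_basis_vector)
    | t in [set t : R | I (\pi_(circle R) t)]].

End Coordinates.

Definition window_length I : R :=
  fine (lebesgue_measure [set t : R | 0 <= t < 1 /\ I (\pi_(circle R) t)]).

Definition gauss_map x : R := frac_part x^-1.

(* For irrational alpha in (0, 1) and j >= 1, the digit a_j of the simple      *)
(* continued fraction alpha = [0; a_1, a_2, ...]; the value at 0 is not used.  *)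
Definition cf_digit alpha (j : nat) : nat :=
  Num.truncn (iter j.-1 gauss_map alpha)^-1.

Fixpoint cf_den alpha (j : nat) {struct j} : nat :=
  match j with
  | 0 => 1
  | j1.+1 => match j1 with
             | 0 => cf_digit alpha 1
             | j2.+1 => cf_digit alpha j * cf_den alpha j1 + cf_den alpha j2
             end
  end%N.

(* c is the digit sequence (c_1, c_2, ...) of the Ostrowski expansion of n,    *)
(* vanishing from c_{N+1} on; c 0 is not used.                                 *)
Definition ostrowski_expansion alpha (c : nat -> nat) (n : nat) :=
  exists N : nat,
  [/\ forall j, (N <= j)%N -> c j.+1 = 0%N,
      n = (\sum_(0 <= j < N) c j.+1 * cf_den alpha j)%N,
      (c 1%N < cf_digit alpha 1)%N,
      forall j, (1 <= j)%N -> (c j.+1 <= cf_digit alpha j.+1)%N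
    & forall j, (1 <= j)%N -> c j.+1 = cf_digit alpha j.+1 -> c j = 0%N].

Definition ostrowski_tail alpha (m : nat) : set nat :=
  [set n | exists2 c, ostrowski_expansion alpha c n &
                      forall j, (j < m)%N -> c j.+1 = 0%N].

Definition ostrowski_interval alpha (m : nat) (gamma : circle R)
    : set (circle R) :=
  [set gamma + z | z in
     closure ([set \pi_(circle R) (n%:R * alpha) | n in ostrowski_tail alpha m]
              : set (quotient_topology (circle R)))].

Definition special_interval alpha I :=
  exists m gamma, (1 <= m)%N /\ I = ostrowski_interval alpha m gamma.

End CutAndProject.

(* Main.v *)
(* Write D_j = q_j alpha - p_j, where alpha = alpha_1 and p_j / q_j are the     *)
(* convergents. By telescoping, J(m, gamma) is a closed arc whose endpoints     *)
(* are -D_m and -D_{m-1}, translated by gamma; its length is                    *)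
(* L = |D_m| + |D_{m-1}|. Fix all integer coordinates but the first: the        *)
(* points of the cut-and-project set on such a row are the integers n such      *)
(* that n alpha - k lies in an interval of length L for some integer k.         *)
(* Expressing (n, k) = u (q_m, p_m) + v (q_{m-1}, p_{m-1}), the integer         *)
(* j = u + v enumerates bijectively the points of the half-open interval, since *)
(* |D_m - D_{m-1}| = L, and n L - j is, up to sign and an additive constant,    *)
(* bounded by |q_m - q_{m-1}| L <= 2. The second endpoint of the closed         *)
(* interval contributes at most one more n because alpha is irrational, and it  *)
(* is inserted by shifting the enumeration. Hence every row is at distance      *)
(* O(1 / L) from Z / L, and so is the whole set from a lattice of V.            *)

Require Import Defs.
From mathcomp Require Import ring lra zify.

Set Implicit Arguments.
Unset Strict Implicit.
Unset Printing Implicit Defensive.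

Local Open Scope classical_set_scope.
Local Open Scope ring_scope.
Local Open Scope quotient_scope.

(** A special interval has length [L = |q alpha - p| + |q' alpha - p'|] for two consecutive
    convergents. Hence [L] lies in Z alpha + Z, with a coefficient [q - q'] of alpha of size at most
    2 / L. This makes the error in counting the visits of n alpha to the interval bounded by an
    absolute constant, uniformly in the position of the interval; dividing by [L] gives the distance
    O(1 / L). The arithmetic is carried by [closure_ostrowski_tail] and [special_interval_arc],
    which turn the Ostrowski description into such an arc, and by [half_open_row] and [closed_row],
    which enumerate one row. The rest is linear algebra: V is a graph over its first coordinates,
    and the rows are assembled into a lattice with spacing 1 / L in the first direction and 1 in the
    others. *)

Section Irrational.
Context {R : realType}.
Implicit Types t : R.

Lemma irrationalV t : irrational t -> irrational t^-1.
Proof. by move=> tI [q _ qt]; apply: tI; exists q^-1; rewrite // fmorphV/= qt invrK. Qed.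

Lemma irrational_frac_part t : irrational t -> irrational (frac_part t).
Proof.
move=> tI [q _ qt]; apply: tI; exists (q + (Num.floor t)%:~R) => //.
by rewrite rmorphD/= qt ratr_int /frac_part subrK.
Qed.

Lemma irrational_neq0 t : irrational t -> t != 0.
Proof. by move=> tI; apply/eqP=> t0; apply: tI; exists 0; rewrite // rmorph0. Qed.

Lemma irrational_mulr_int t (n p : int) :
  irrational t -> n%:~R * t = p%:~R -> n = 0.
Proof.
move=> tI ntp; apply/eqP; apply: contra_notT tI => n0.
exists (p%:~R / n%:~R) => //.
by rewrite fmorph_div/= !ratr_int -ntp mulrC mulKf// intr_eq0.
Qed.

Lemma frac_part_itv t : 0 <= frac_part t < 1.
Proof. by have := floor_itv t; rewrite /frac_part intrD; lra. Qed.

Lemma irrational_frac_part_itv t : irrational t -> 0 < frac_part t < 1.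
Proof.
move=> tI; have /andP[t0 ->] := frac_part_itv t.
by rewrite andbT lt0r t0 irrational_neq0//; exact: irrational_frac_part.
Qed.

End Irrational.

(** * Continued fractions and alternating sums of Ostrowski digits *)

Section ContinuedFraction.
Context {R : realType} (alpha : R).
Hypotheses (alpha01 : 0 < alpha < 1) (alphaI : irrational alpha).

Local Notation a := (cf_digit alpha).
Local Notation q := (cf_den alpha).

Fixpoint cf_num (j : nat) {struct j} : nat :=
  match j with
  | 0 => 0
  | j1.+1 => match j1 with
             | 0 => 1
             | j2.+1 => a j * cf_num j1 + cf_num j2
             end
  end%N.

(* [cf_gap 0 = 1] and [cf_gap j.+1 = |q_j alpha - p_j|]. *)
Definition cf_gap (j : nat) : R := \prod_(i < j) iter i gauss_map alpha.

Lemma gauss_iter_irrational j :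
  0 < iter j gauss_map alpha < 1 /\ irrational (iter j gauss_map alpha).
Proof.
elim: j => [//|j [x01 xI]] /=; split.
  exact/irrational_frac_part_itv/irrationalV.
exact/irrational_frac_part/irrationalV.
Qed.

Lemma gap_gt0 j : 0 < cf_gap j.
Proof. by apply: prodr_gt0 => i _; have [/andP[]] := gauss_iter_irrational i. Qed.

(** With x_j the j-th Gauss iterate, x_{j+1} = 1 / x_j - a_{j+1}, so 1 = a_{j+1} x_j + x_j x_{j+1};
    multiply by the product of the earlier iterates. *)
Lemma gap_rec j : cf_gap j = (a j.+1)%:R * cf_gap j.+1 + cf_gap j.+2.
Proof.
have [/andP[x0 x1] _] := gauss_iter_irrational j.
have E : (a j.+1)%:R = (Num.floor (iter j gauss_map alpha)^-1)%:~R :> R.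
  rewrite /cf_digit/= truncn_floor invr_ge0 ltW//.
  by rewrite -[LHS]/(_%:Z%:~R) gez0_abs// floor_ge0 invr_ge0 ltW.
have {E} : iter j.+1 gauss_map alpha = (iter j gauss_map alpha)^-1 - (a j.+1)%:R.
  by rewrite E.
rewrite /cf_gap !big_ord_recr/= -/(cf_gap j) => ->.
by field; rewrite gt_eqF.
Qed.

Lemma cf_digit_gt0 j : (0 < a j.+1)%N.
Proof.
have [/andP[x0 x1] _] := gauss_iter_irrational j.
by rewrite /cf_digit truncn_gt0/= invf_ge1// ltW.
Qed.

Lemma cf_digit_ge1 j : 1 <= (a j.+1)%:R :> R.
Proof. by rewrite ler1n cf_digit_gt0. Qed.

Lemma gapS_le j : cf_gap j.+1 <= cf_gap j.
Proof.
have := gap_rec j; have := gap_gt0 j.+1; have := gap_gt0 j.+2.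
by have := cf_digit_ge1 j; nra.
Qed.

Lemma gapSS_le j : cf_gap j.+2 *+ 2 <= cf_gap j.
Proof.
have := gap_rec j; have := gapS_le j.+1; have := gap_gt0 j.+2.
by have := cf_digit_ge1 j; nra.
Qed.

Lemma gap_le1 j : cf_gap j <= 1.
Proof. by elim: j => [|j]; [rewrite /cf_gap big_ord0|exact/le_trans/gapS_le]. Qed.

Lemma gap_small m (e : R) : 0 < e -> exists n, cf_gap (m + n) < e.
Proof.
(* The gap at least halves every two steps, and 2^k >= k + 1 > 1 / e. *)
move=> e0; pose k := Num.truncn e^-1; exists k.*2.
have geo i : cf_gap (m + i.*2) *+ 2 ^ i <= 1.
  elim: i => [|i]; first by rewrite addn0 expn0 gap_le1.
  apply: le_trans; rewrite doubleS !addnS expnS mulrnA.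
  by rewrite lerMn2r gapSS_le orbT.
have ke : e^-1 < k.+1%:R by rewrite truncnS_gt.
have {ke} : 1 < k.+1%:R * e by rewrite -ltr_pdivrMr// div1r.
have : k.+1%:R <= (2 ^ k)%:R :> R by rewrite ler_nat ltn_expl.
have := geo k; rewrite -[cf_gap _ *+ _]mulr_natl; have := gap_gt0 (m + k.*2).
move: (cf_gap _) ((2 ^ k)%:R : R) (k.+1%:R : R) (ler0n R k.+1) => g y z; nra.
Qed.

Lemma cf_den_gap j : (q j)%:R * alpha - (cf_num j)%:R = (-1) ^+ j * cf_gap j.+1.
Proof.
have gap1 : cf_gap 1 = alpha by rewrite /cf_gap big_ord1.
have gap0 : cf_gap 0 = 1 by rewrite /cf_gap big_ord0.
(* The recurrences have order two, so the induction carries two consecutive indices. *)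
suff [] : (q j)%:R * alpha - (cf_num j)%:R = (-1) ^+ j * cf_gap j.+1 /\
  (q j.+1)%:R * alpha - (cf_num j.+1)%:R = (-1) ^+ j.+1 * cf_gap j.+2 by [].
elim: j => [|j [E1 E2]].
  split; first by rewrite mul1r subr0 expr0 mul1r gap1.
  by have := gap_rec 0; rewrite gap0 gap1 expr1 /=; lra.
split=> //; rewrite -[q j.+2]/(a j.+2 * q j.+1 + q j)%N.
rewrite -[cf_num j.+2]/(a j.+2 * cf_num j.+1 + cf_num j)%N.
have := gap_rec j.+1; rewrite !natrD !natrM => E3.
have -> : cf_gap j.+3 = cf_gap j.+1 - (a j.+2)%:R * cf_gap j.+2 by rewrite E3; ring.
have -> : (-1) ^+ j.+2 = (-1) ^+ j :> R by rewrite !exprS; ring.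
transitivity ((a j.+2)%:R * ((q j.+1)%:R * alpha - (cf_num j.+1)%:R) +
  ((q j)%:R * alpha - (cf_num j)%:R)); first ring.
by rewrite E1 E2 exprS; ring.
Qed.

Lemma cf_det j :
  (q j.+1)%:Z * (cf_num j)%:Z - (q j)%:Z * (cf_num j.+1)%:Z = (-1) ^+ j.+1.
Proof.
elim: j => [|j IH]; first by rewrite /= expr1 mulr0 mul1r sub0r.
rewrite exprS -IH -[q j.+2]/(a j.+2 * q j.+1 + q j)%N.
rewrite -[cf_num j.+2]/(a j.+2 * cf_num j.+1 + cf_num j)%N.
by rewrite !PoszD !PoszM; ring.
Qed.

(** The recurrences of the denominators and of the gaps leave this expression invariant. It bounds a
    denominator by the inverse of a gap, whence the bound 2 in [special_interval_arc]. *)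
Lemma cf_den_gap_sum j : (q j.+1)%:R * cf_gap j.+1 + (q j)%:R * cf_gap j.+2 = 1.
Proof.
elim: j => [|j IH].
  by rewrite mul1r -gap_rec /cf_gap big_ord0.
rewrite -[q j.+2]/(a j.+2 * q j.+1 + q j)%N natrD natrM.
by rewrite -[RHS]IH (gap_rec j.+1); ring.
Qed.

Lemma cf_den_le j : (q j <= q j.+1)%N.
Proof.
case: j => [|j]; first exact: cf_digit_gt0.
rewrite -[q j.+2]/(a j.+2 * q j.+1 + q j)%N.
by apply: leq_trans (leq_addr _ _); rewrite leq_pmull// cf_digit_gt0.
Qed.

Lemma cf_den_gt0 j : (0 < q j)%N.
Proof. by elim: j => // j qj; apply: leq_trans qj _; exact: cf_den_le. Qed.

(** This is (-1)^m times the sum of c_{j+1} (q_j alpha - p_j) over m <= j < m + n. The sign makes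
    the leading digit count positively, so that the recursion [alt_sumS] does not depend on the
    parity of m. *)
Definition alt_sum (c : nat -> nat) m n : R :=
  \sum_(i < n) (-1) ^+ i * (c (m + i).+1)%:R * cf_gap (m + i).+1.

Lemma alt_sumS c m n :
  alt_sum c m n.+1 = (c m.+1)%:R * cf_gap m.+1 - alt_sum c m.+1 n.
Proof.
rewrite /alt_sum big_ord_recl addn0 mul1r -sumrN; congr (_ + _).
by apply: eq_bigr => i _; rewrite /= /bump/= addnA addn1 exprS mulN1r !mulNr.
Qed.

(** Induction on n for all m at once, through [alt_sumS]. The extreme values are approached by
    digits alternately maximal and zero, for which [gap_rec] makes the sum telescope. *)
Lemma alt_sum_bounds (c : nat -> nat) m n :
  (forall j, (m <= j)%N -> (c j.+1 <= a j.+1)%N) ->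
  (forall j, (m < j)%N -> c j.+1 = a j.+1 -> c j = 0%N) ->
  [/\ - cf_gap m.+1 <= alt_sum c m n, alt_sum c m n <= cf_gap m &
      (c m.+1 < a m.+1)%N -> alt_sum c m n <= cf_gap m - cf_gap m.+1].
Proof.
elim: n m => [|n IH] m ca carry.
  have := gap_gt0 m.+1; have := gapS_le m.
  by rewrite /alt_sum big_ord0; split; lra.
have [||lo hi hi'] := IH m.+1.
- by move=> j mj; apply: ca; exact: ltnW.
- by move=> j mj; apply: carry; exact: ltnW.
rewrite alt_sumS; have g1 := gap_gt0 m.+1; have g2 := gap_gt0 m.+2.
have : (c m.+1)%:R <= (a m.+1)%:R :> R by rewrite ler_nat ca.
have := gap_rec m; move=> E cam; split.
- have [->|cN0] := eqVneq (c m.+1) 0%N; first by rewrite mul0r; lra.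
  have : 1 <= (c m.+1)%:R :> R by rewrite ler1n lt0n.
  have /hi' : (c m.+2 < a m.+2)%N.
    rewrite ltn_neqAle ca ?leqW// andbT; apply: contraNneq cN0 => e.
    by apply/eqP/carry.
  nra.
- nra.
- by rewrite -(ler_nat R) -natr1; nra.
Qed.

(* Greedy choice of the digits; the flag [b] records that the preceding digit
   is nonzero, so that the next one may not be maximal. *)
Lemma alt_sum_dense n m (b : bool) (z : R) :
  - cf_gap m.+1 <= z -> z <= cf_gap m -> (b -> z <= cf_gap m - cf_gap m.+1) ->
  exists c : nat -> nat,
  [/\ forall j, (j <= m)%N || (m + n < j)%N -> c j = 0%N,
      forall j, (c j.+1 <= a j.+1)%N,
      forall j, c j.+1 = a j.+1 -> c j = 0%N,
      b -> (c m.+1 < a m.+1)%N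
    & `|z - alt_sum c m n| <= cf_gap (m + n)].
Proof.
elim: n m b z => [|n IH] m b z lo hi hib.
  exists (fun=> 0%N); split=> //; first by rewrite cf_digit_gt0.
  rewrite /alt_sum big_ord0 subr0 addn0 ler_norml hi andbT.
  by apply: le_trans lo; rewrite lerN2 gapS_le.
have E := gap_rec m; have g1 := gap_gt0 m.+1; have g2 := gap_gt0 m.+2.
(* The greedy digit is the least [d] that keeps the remainder [d%:R * cf_gap m.+1 - z] above
   [- cf_gap m.+2], as the next level requires. If [d] is positive, minimality also gives the
   sharper upper bound required after a nonzero digit. *)
have exd : exists d, z <= d%:R * cf_gap m.+1 + cf_gap m.+2.
  by exists (a m.+1); rewrite -E.
pose d := ex_minn exd.
have [zd dmin] : z <= d%:R * cf_gap m.+1 + cf_gap m.+2 /\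
    forall d', z <= d'%:R * cf_gap m.+1 + cf_gap m.+2 -> (d <= d')%N.
  by rewrite /d; case: ex_minnP.
have da : (d <= a m.+1)%N by apply: dmin; rewrite -E.
have dlo : (0 < d)%N -> d%:R * cf_gap m.+1 - z <= cf_gap m.+1 - cf_gap m.+2.
  move=> d0; have : ~~ (z <= d.-1%:R * cf_gap m.+1 + cf_gap m.+2).
    by apply/negP => /dmin; rewrite -ltnS prednK// ltnn.
  by rewrite -ltNge -[in d%:R](prednK d0) -natr1; lra.
have [|||c [c0 ca carry cb cz]] := IH m.+1 (0 < d)%N (d%:R * cf_gap m.+1 - z).
- lra.
- have [d0|] := posnP d; first by rewrite d0 mul0r; lra.
  by move/dlo; lra.
- exact: dlo.
exists (fun j => if j == m.+1 then d else c j); split.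
- move=> j; case: eqP => [->|_ jmn]; first by rewrite ltnn addnS !ltnS -ltn_subRL subnn.
  by apply: c0; rewrite addSnnS; case/orP: jmn => [/leqW->//|->]; rewrite orbT.
- by move=> j; case: eqP => [[->]|_].
- move=> j; case: eqP => [[-> _]|_].
    by rewrite ltn_eqF// c0// leqnSn.
  case: eqP => [->|_]; last exact: carry.
  case: (posnP d) => // /cb + e; by rewrite e ltnn.
- move=> bT; rewrite eqxx ltn_neqAle da andbT; apply/eqP => dE.
  suff /dmin : z <= (a m.+1).-1%:R * cf_gap m.+1 + cf_gap m.+2.
    by rewrite dE -ltnS prednK ?cf_digit_gt0// ltnn.
  have := hib bT; have : (a m.+1)%:R = (a m.+1).-1%:R + 1 :> R.
    by rewrite natr1 prednK ?cf_digit_gt0.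
  by nra.
- rewrite alt_sumS eqxx addnS -addSn; apply: le_trans cz.
  rewrite -normrN le_eqVlt; apply/orP; left; apply/eqP; congr (`|_|).
  suff -> : alt_sum (fun j => if j == m.+1 then d else c j) m.+1 n =
            alt_sum c m.+1 n by ring.
  apply: eq_bigr => i _; rewrite ifN//; lia.
Qed.
End ContinuedFraction.

(** * Closed arcs of the circle *)

Section Circle.
Context {R : realType}.
Implicit Types (s t : R).

Lemma pi_circleP s t :
  \pi_(circle R) s = \pi_(circle R) t <-> exists p : int, s = t + p%:~R.
Proof.
split=> [/eqmodP|[p ->]].
  rewrite /= Quotient.equivE => /intrP[p e]; exists p.
  by rewrite -e addrC subrK.
by apply/eqmodP; rewrite /= Quotient.equivE addrC addKr; exact: intr_int.
Qed.

Lemma pi_circleD s t : \pi_(circle R) (s + t) = \pi_(circle R) s + \pi_(circle R) t.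
Proof. exact: raddfD. Qed.

Lemma closed_arc (lo hi : R) :
  closed ([set \pi_(circle R) z | z in `[lo, hi]]
          : set (quotient_topology (circle R))).
Proof.
rewrite -openC.
suff E : \pi_(circle R) @^-1` (~` [set \pi_(circle R) z | z in `[lo, hi]]) =
    \bigcup_(k : int) `]hi + k%:~R, lo + (k + 1)%:~R[%classic.
  (* Openness in the quotient topology is, by conversion, openness of the preimage; here the
     preimage is the union of the gaps between consecutive integer translates. *)
  change (open (\pi_(circle R) @^-1` (~` [set \pi_(circle R) z | z in `[lo, hi]]) : set R)).
  by rewrite E; apply: bigcup_open => k _; exact: interval_open.
apply/seteqP; split=> t /=.
  move=> tJ; exists (Num.floor (t - lo)) => //=.
  have := floor_itv (t - lo); rewrite in_itv/= intrD => /andP[klo khi].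
  apply/andP; split; last lra.
  rewrite ltNge; apply/negP => thi; apply: tJ.
  exists (t - (Num.floor (t - lo))%:~R); first by rewrite /= in_itv/=; apply/andP; lra.
  by apply/pi_circleP; exists (- Num.floor (t - lo)); rewrite intrN.
move=> [k _ /=]; rewrite in_itv/= => /andP[tlo thi] [z] /=.
rewrite in_itv/= => /andP[zlo zhi] /pi_circleP[p zp].
have : (k + p < 0)%R by rewrite -(ltr_int R) intrD; lra.
have : (0 < k + 1 + p)%R by rewrite -(ltr_int R) 2!intrD; move: thi; rewrite intrD; lra.
lia.
Qed.

End Circle.

(** * Special intervals are closed arcs *)

Section SpecialInterval.
Context {R : realType} (alpha : R).
Hypotheses (alpha01 : 0 < alpha < 1) (alphaI : irrational alpha).

Local Notation a := (cf_digit alpha).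
Local Notation q := (cf_den alpha).
Local Notation p := (cf_num alpha).

Lemma ostrowski_sum_alt_sum (c : nat -> nat) m n :
  (forall j, (j < m)%N -> c j.+1 = 0%N) ->
  (\sum_(0 <= j < m + n) c j.+1 * q j)%:R * alpha
    - (\sum_(0 <= j < m + n) c j.+1 * p j)%:R
  = (-1) ^+ m * alt_sum alpha c m n.
Proof.
move=> c0; rewrite !natr_sum mulr_suml -sumrB.
rewrite (big_cat_nat (n := m)) ?leq_addr//= big_nat big1 ?add0r; last first.
  by move=> j /andP[_ jm]; rewrite c0// !mul0n mul0r subr0.
rewrite -{1}[m]add0n big_addn addKn big_mkord /alt_sum mulr_sumr.
apply: eq_bigr => i _; rewrite !natrM [(i + m)%N]addnC.
rewrite -mulrA -mulrBr cf_den_gap// exprD; ring.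
Qed.

(** A lift to the line of the untranslated special interval of level m; the sign (-1)^m absorbs the
    dependence of its endpoints on parity. *)
Let arc m : set R :=
  [set z | - cf_gap alpha m.+1 <= (-1) ^+ m * z <= cf_gap alpha m].

Let arcE m : arc m =
  `[- cf_gap alpha (m + ~~ odd m), cf_gap alpha (m + odd m)]%classic.
Proof.
rewrite /arc -signr_odd; apply/seteqP; split=> z /=; rewrite in_itv/=;
  case: (odd m); rewrite ?addn0 ?addn1 ?expr1 ?expr0; lra.
Qed.

(** The points lie in the arc by [alt_sum_bounds], and the arc is closed. Conversely,
    [alt_sum_dense] approximates each point of the arc by a finite expansion, with an error that
    [gap_small] makes arbitrarily small. *)
Lemma closure_ostrowski_tail m : (0 < m)%N ->
  closure ([set \pi_(circle R) (n%:R * alpha) | n in ostrowski_tail alpha m]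
           : set (quotient_topology (circle R)))
  = [set \pi_(circle R) z | z in arc m].
Proof.
move=> m0; apply/seteqP; split.
  rewrite arcE; apply: subset_trans (@closed_arc _ _ _); apply: closureS.
  rewrite -arcE => _ [n [c [N [cN nE c1 ca carry]] cm] <-].
  (* Starting at m, [N] digits reach index m + N, beyond the end of the expansion; the additional
     digits vanish. *)
  exists ((-1) ^+ m * alt_sum alpha c m N).
    have [||lo hi _] := @alt_sum_bounds R alpha alpha01 alphaI c m N.
    - by move=> j mj; apply: ca; apply: leq_trans mj.
    - by move=> j mj; apply: carry; apply: leq_ltn_trans mj.
    by rewrite /arc/= mulrA -expr2 sqrr_sign mul1r lo.
  rewrite -ostrowski_sum_alt_sum//; apply/pi_circleP.
  exists (- (\sum_(0 <= j < m + N) c j.+1 * p j)%N%:Z); rewrite intrN; congr (_%:R * _ - _).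
  rewrite nE [LHS](big_cat_nat (n := N)) ?leq_addl//=.
  rewrite [X in (_ + X)%N = _]big_nat [X in (_ + X)%N = _]big1 ?addn0// => j /andP[Nj _].
  by rewrite cN.
move=> _ [z /andP[zlo zhi] <-] B; rewrite nbhsE => -[U [oU Uz] UB].
have /nbhs_ballP[e /= e0 eU] : nbhs z (\pi_(circle R) @^-1` U).
  by rewrite nbhsE; exists (\pi_(circle R) @^-1` U).
have [n gn] := gap_small alpha01 alphaI m e0.
have [//|c [c0 ca carry _ cz]] :=
  @alt_sum_dense R alpha alpha01 alphaI n m false ((-1) ^+ m * z) zlo zhi.
pose s := (\sum_(0 <= j < m + n) c j.+1 * q j)%N.
exists (\pi_(circle R) (s%:R * alpha)); split.
  exists s => //; exists c; last by move=> j jm; rewrite c0// jm.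
  exists (m + n)%N; split=> //.
  - by move=> j mj; rewrite c0// ltnS mj orbT.
  - by rewrite c0 ?m0// (cf_digit_gt0 alpha01 alphaI).
  - by move=> j _; exact: carry.
apply: UB; have -> : \pi_(circle R) (s%:R * alpha) =
    \pi_(circle R) ((-1) ^+ m * alt_sum alpha c m n).
  apply/pi_circleP; exists (\sum_(0 <= j < m + n) c j.+1 * p j)%N%:Z.
  by rewrite -ostrowski_sum_alt_sum ?subrK// => j jm; rewrite c0// jm.
apply: eU; rewrite /ball/=; apply: le_lt_trans gn; apply: le_trans cz.
rewrite -[leLHS]mul1r -{1}(normr_sign R m) -normrM mulrBr mulrA -expr2 sqrr_sign.
by rewrite mul1r.
Qed.

End SpecialInterval.

(** All that the counting argument needs about a special interval: a unimodular pair of integer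
    vectors, a width [L] that is the difference of their two values, and the bound on [q - q']. *)
Lemma special_interval_arc (R : realType) (alpha : R) (I : set (circle R)) :
  irrational alpha -> special_interval (frac_part alpha) I ->
  exists (q p q' p' : int) (g L : R),
  [/\ L = (q%:~R * alpha - p%:~R) - (q'%:~R * alpha - p'%:~R),
      q * p' - q' * p = 1,
      0 < L <= 1 /\ `|(q - q')%:~R| * L <= 2,
      0 <= g < 1
    & forall t : R, I (\pi_(circle R) t) <->
        exists k : int, g <= t - k%:~R <= g + L].
Proof.
move=> alphaI [[|m] [gamma [//= _ ->]]].
set beta := frac_part alpha; pose F := Num.floor alpha.
have betaE : beta = alpha - F%:~R by [].
have b01 : 0 < beta < 1 by exact: irrational_frac_part_itv.
have bI : irrational beta by exact: irrational_frac_part.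
pose q := cf_den beta; pose p := cf_num beta; pose g := cf_gap beta.
have g0 j : 0 < g j by exact: gap_gt0.
have gle j : g j.+1 <= g j by exact: gapS_le.
have qgap : (q m.+1)%:R * g m.+1 + (q m)%:R * g m.+2 = 1 :> R by exact: cf_den_gap_sum.
have qle : (q m)%:R <= (q m.+1)%:R :> R by rewrite ler_nat; exact: cf_den_le.
have q0 : 0 <= (q m)%:R :> R by exact: ler0n.
have q1 : 1 <= (q m)%:R :> R.
  by rewrite ler1n; exact: cf_den_gt0.
have L2 : (q m.+1)%:R * (g m.+1 + g m.+2) <= 2.
  have := gle m.+1; have := g0 m.+2; nra.
have L1 : g m.+1 + g m.+2 <= 1.
  have := g0 m.+1; have := g0 m.+2; nra.
have D j : (q j)%:R * alpha - ((p j)%:R + (q j)%:R * F%:~R) = (-1) ^+ j * g j.+1.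
  by rewrite -cf_den_gap// betaE; ring.
have det : (q m.+1)%:Z * (p m)%:Z - (q m)%:Z * (p m.+1)%:Z = (-1) ^+ m.+1 by exact: cf_det.
pose lo : R := - g (m.+1 + ~~ odd m.+1)%N; pose r := repr gamma.
(* [i1] is the even and [i2] the odd index of the two, so that both the width and the determinant
   come out positive. The numerators are then shifted by multiples of [F] to pass from [beta] back
   to [alpha]. *)
pose i1 := if odd m then m.+1 else m; pose i2 := if odd m then m else m.+1.
exists (q i1), ((p i1)%:Z + (q i1)%:Z * F), (q i2), ((p i2)%:Z + (q i2)%:Z * F).
exists (frac_part (r + lo)), (g m.+1 + g m.+2); split.
- rewrite !intrD !intrM -!pmulrn [X in _ = X - _]D [X in _ = _ - X]D.
  rewrite /i1 /i2; case: ifP => om.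
    by rewrite -signr_odd -[X in _ - X * _]signr_odd /= om /=; ring.
  by rewrite -signr_odd -[X in _ - X * _]signr_odd /= om /=; ring.
- move: det; rewrite exprS -signr_odd /i1 /i2; case: (odd m) => /=; lia.
- split; first by have := g0 m.+1; have := g0 m.+2; lra.
  apply: le_trans L2; rewrite ler_pM2r; last by have := g0 m.+1; have := g0 m.+2; lra.
  rewrite ler_norml intrB -!pmulrn /i1 /i2; case: (odd m); lra.
- exact: frac_part_itv.
have inarc z : (- g m.+2 <= (-1) ^+ m.+1 * z <= g m.+1)
    = (lo <= z <= lo + (g m.+1 + g m.+2)).
  rewrite /lo exprS -signr_odd oddS negbK; case: (odd m);
    rewrite ?addn0 ?addn1 ?expr1 ?expr0; lra.
move=> t; rewrite /ostrowski_interval closure_ostrowski_tail//.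
have gammaE : gamma = \pi_(circle R) r by rewrite reprK.
rewrite gammaE /frac_part; split=> [[_ [z /= + <-]]|[k rt]].
  rewrite inarc -pi_circleD => zlo /pi_circleP[k rzt].
  exists (Num.floor (r + lo) - k); rewrite intrB; lra.
exists (\pi_(circle R) (t - k%:~R + (Num.floor (r + lo))%:~R - r)).
  by eexists; last reflexivity; rewrite /= inarc; lra.
rewrite -pi_circleD; apply/pi_circleP; exists (Num.floor (r + lo) - k).
by rewrite intrB; ring.
Qed.

(** At most the two translates of the arc by 0 and -1 meet [0, 1), whence the factor 2, which is
    absorbed in the final constant. The piece of the arc just right of [g] gives positivity. *)
Lemma window_length_bounds (R : realType) (I : set (circle R)) (g L : R) :
  0 <= g < 1 -> 0 < L <= 1 ->
  (forall t : R, I (\pi_(circle R) t) <->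
     exists k : int, g <= t - k%:~R <= g + L) ->
  0 < window_length I <= L *+ 2.
Proof.
move=> /andP[g0 g1] /andP[L0 L1] IE; rewrite /window_length.
set A := [set t : R | _]; pose mu := @lebesgue_measure R.
pose B : set R := `[g, Num.min 1 (g + L)[%classic.
pose C1 : set R := `[g, g + L]%classic; pose C2 : set R := `[g - 1, g - 1 + L]%classic.
have AE : A = `[0, 1[%classic `&` (C1 `|` C2).
  apply/seteqP; split=> t; rewrite /C1 /C2 /= !in_itv/= => -[/andP[t0 t1]].
    move=> /IE[k /andP[klo khi]]; split; first by rewrite t0.
    have k1 : (k < 1)%R by rewrite -(ltr_int R); lra.
    have k2 : (-2 < k)%R by rewrite -(ltr_int R); lra.
    have : (k = 0 \/ k = -1)%R by lia.
    by case=> kE; rewrite kE in klo khi; [left|right]; lra.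
  move=> tC; split; first by rewrite t0.
  by apply/IE; case: tC => ?; [exists 0|exists (-1)]; lra.
have mC : measurable (C1 `|` C2) by apply: measurableU; exact: measurable_itv.
have mA : measurable A by rewrite AE; apply: measurableI mC; exact: measurable_itv.
have muA : (mu A <= (L *+ 2)%:E)%E.
  apply: (@le_trans _ _ (mu (C1 `|` C2))%E).
    by apply: le_measure; rewrite ?inE// AE => t [].
  apply: (@le_trans _ _ (mu C1 + mu C2)%E); first by apply: measureU2; exact: measurable_itv.
  have -> : mu C1 = L%:E.
    by rewrite /mu /C1 lebesgue_measure_itv/= lte_fin ltrDl L0 -EFinB addrAC subrr add0r.
  have -> : mu C2 = L%:E.
    by rewrite /mu /C2 lebesgue_measure_itv/= lte_fin ltrDl L0 -EFinB addrAC subrr add0r.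
  by rewrite -EFinD mulr2n.
have muB : (0 < mu B)%E.
  rewrite /mu /B lebesgue_measure_itv/= lte_fin lt_min g1 ltrDl L0/= -EFinB lte_fin.
  by rewrite subr_gt0 lt_min g1 ltrDl.
have muBA : (mu B <= mu A)%E.
  apply: le_measure; rewrite ?inE//; first exact: measurable_itv.
  move=> t; rewrite /B /A/= in_itv/= lt_min => /and3P[gt t1 tgL]; split.
    by rewrite t1 (le_trans g0 gt).
  by apply/IE; exists 0; rewrite subr0 gt ltW.
have fA : mu A \is a fin_num.
  rewrite ge0_fin_numE; last exact: measure_ge0.
  by apply: le_lt_trans muA _; exact: ltry.
by rewrite fine_gt0 ?(lt_le_trans muB muBA) -?ge0_fin_numE//= -lee_fin fineK.
Qed.

(** Values from [j0] on move up by one to free [j0] for the new element; no old value moves by more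
    than 1. *)
Lemma set_bij_insert (A : set int) (phi : int -> int) (n0 j0 : int) :
  ~ A n0 -> set_bij A [set: int] phi ->
  set_bij (A `|` [set n0]) [set: int]
    (fun n => if n == n0 then j0 else if phi n < j0 then phi n else phi n + 1).
Proof.
move=> An0 [_ phi_inj phi_surj]; split=> //.
- move=> m n; rewrite !inE => Am An.
  case: eqP => [->|mN]; case: eqP => [->|nN] //; do ?[case: ltP => ?]; try lia.
  + move=> e; apply: phi_inj => //; rewrite inE; [by case: Am|by case: An].
  + move=> e; apply: phi_inj; last lia; rewrite inE; [by case: Am|by case: An].
- move=> j _; have [->|] := eqVneq j j0; first by exists n0; [right|rewrite eqxx].
  rewrite neq_lt => /orP jj0.
  have [n An nE] := phi_surj (if j < j0 then j else j - 1) I.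
  have /negPf nn0 : n != n0 by apply/eqP => nn0; apply: An0; rewrite -nn0.
  exists n; [by left|rewrite nn0 nE].
  by case: (ltP j j0) => ?; [rewrite ifT|rewrite ifN]; lia.
Qed.

(** * Enumeration of the points on one row *)

Section Row.
Context {R : realType} (alpha L : R) (q p q' p' : int).
Hypotheses (alphaI : irrational alpha)
  (LE : L = (q%:~R * alpha - p%:~R) - (q'%:~R * alpha - p'%:~R))
  (det : q * p' - q' * p = 1) (L01 : 0 < L <= 1)
  (qL : `|(q - q')%:~R| * L <= 2).

(* In the basis (q, p), (q', p') of Z^2, write (n, k) = u (q, p) + v (q', p').
   On the strip the sum u + v determines (n, k), because moving along
   (q, p) - (q', p') changes n alpha - k by exactly the width L. *)
Lemma half_open_row (lo : R) :
  exists (phi : int -> int) (s : R),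
    set_bij [set n : int | exists k : int, lo <= n%:~R * alpha - k%:~R < lo + L]
      [set: int] phi /\
    forall n : int, (exists k : int, lo <= n%:~R * alpha - k%:~R < lo + L) ->
      `|n%:~R * L - (phi n)%:~R - s| <= 2.
Proof.
have /andP[L0 L1] := L01.
(* As L <= 1, an n in the strip has only one admissible k. *)
pose k (n : int) := Num.floor (n%:~R * alpha - lo).
have kE n (l : int) : lo <= n%:~R * alpha - l%:~R < lo + L -> l = k n.
  by move=> nl; apply/esym/floor_def; rewrite intrD; lra.
(* Cramer's rule with determinant 1 gives u = n p' - k q' and v = k q - n p; [phi n] is u + v. *)
pose phi n := n * (p' - p) + k n * (q - q').
have phiE n : (phi n)%:~R = n%:~R * L - (q - q')%:~R * (n%:~R * alpha - (k n)%:~R).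
  by rewrite LE /phi !(intrD, intrM, intrB); ring.
have LdetE : (q%:~R * p'%:~R - q'%:~R * p%:~R = 1 :> R).
  by rewrite -!intrM -intrB det.
exists phi, ((q - q')%:~R * lo); split; last first.
  move=> n [l nl]; have lk := kE _ _ nl; rewrite lk in nl; rewrite phiE.
  have -> : n%:~R * L - (n%:~R * L - (q - q')%:~R * (n%:~R * alpha - (k n)%:~R))
    - (q - q')%:~R * lo = (q - q')%:~R * (n%:~R * alpha - (k n)%:~R - lo) by ring.
  rewrite normrM; apply: le_trans qL; apply: ler_wpM2l => //.
  by rewrite ger0_norm; lra.
split=> //.
- move=> m n; rewrite !inE => -[l ml] [l' nl']; rewrite /phi -(kE _ _ ml) -(kE _ _ nl') => e.
  have {}e : (m - n) * (p' - p) + (l - l') * (q - q') = 0.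
    by move/eqP: e; rewrite -subr_eq0 => /eqP <-; ring.
  (* [w] is the u-coordinate of the difference of the two points. Since u + v vanishes there, the
     difference is [w] times (q, p) - (q', p'), which moves the value by [w] L; two points of the
     strip are less than L apart, so [w] is 0. *)
  pose w := (m - n) * p' - (l - l') * q'.
  have wq : m - n = w * (q - q').
    rewrite -[LHS]mulr1 -det; apply/eqP; rewrite -subr_eq0; apply/eqP.
    by rewrite -[RHS](mulr0 q') -e /w; ring.
  have wp : l - l' = w * (p - p').
    rewrite -[LHS]mulr1 -det; apply/eqP; rewrite -subr_eq0; apply/eqP.
    by rewrite -[RHS](mulr0 p') -e /w; ring.
  have wL : w%:~R * L = (m%:~R * alpha - l%:~R) - (n%:~R * alpha - l'%:~R).
    transitivity ((m - n)%:~R * alpha - (l - l')%:~R); last by rewrite !intrB; ring.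
    by rewrite wq wp LE !(intrM, intrB); ring.
  have w1 : w%:~R < 1 :> R by rewrite -(ltr_pM2r L0) mul1r; lra.
  have w2 : -1 < w%:~R :> R by rewrite -(ltr_pM2r L0) mulN1r; lra.
  have w0 : w = 0.
    have : (w < 1)%R by rewrite -(ltr_int R).
    have : (-1 < w)%R by rewrite -(ltr_int R).
    lia.
  by apply/eqP; rewrite -subr_eq0 wq w0 mul0r.
(* On the line u + v = j, start from j (q', p'); successive points differ in value by L, so one of
   them falls into the half-open strip. *)
- move=> j _; pose z0 := j%:~R * (q'%:~R * alpha - p'%:~R) : R.
  pose u := - Num.floor ((z0 - lo) / L).
  have [ulo uhi] : lo <= z0 + u%:~R * L /\ z0 + u%:~R * L < lo + L.
    have := floor_itv ((z0 - lo) / L); rewrite ler_pdivlMr// ltr_pdivrMr// !intrD.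
    by rewrite /u intrN mulrDl mulNr; lra.
  have nl : lo <= (u * q + (j - u) * q')%:~R * alpha - (u * p + (j - u) * p')%:~R < lo + L.
    suff -> : (u * q + (j - u) * q')%:~R * alpha - (u * p + (j - u) * p')%:~R
      = z0 + u%:~R * L by rewrite ulo.
    by rewrite LE /z0 !(intrD, intrM, intrB); ring.
  exists (u * q + (j - u) * q'); first by exists (u * p + (j - u) * p').
  rewrite /phi -(kE _ _ nl) -[RHS]mulr1 -det; ring.
Qed.

(** Two different n at the right endpoint would make alpha rational, so at most one n is added to
    the half-open row. The constant is 4 = 2 + 1 + 1: the half-open row, the shift that inserts the
    extra point, and the rounding of the offset to an integer. *)
Lemma closed_row (lo s : R) :
  exists psi : int -> int,
    set_bij [set n : int | exists k : int, lo <= n%:~R * alpha - k%:~R <= lo + L]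
      [set: int] psi /\
    forall n : int, (exists k : int, lo <= n%:~R * alpha - k%:~R <= lo + L) ->
      `|n%:~R * L - s - (psi n)%:~R| <= 4.
Proof.
set B := [set n : int | _].
have [phi [s0 []]] := half_open_row lo.
set A := [set n : int | _] => phi_bij phi_near.
suff [psi [psi_bij psi_near]] : exists psi : int -> int,
    set_bij B [set: int] psi /\
    forall n, B n -> `|n%:~R * L - (psi n)%:~R - s0| <= 3.
  pose j := Num.floor (s0 - s); exists (fun n => psi n + j); split.
    have [_ psi_inj psi_surj] := psi_bij; split=> // [m n mB nB|i _].
      by move=> /addIr; exact: psi_inj.
    by have [n Bn nE] := psi_surj (i - j) I; exists n; rewrite // nE subrK.
  move=> n /psi_near; have := floor_itv (s0 - s); rewrite -/j !intrD.
  by rewrite !ler_norml; lra.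
have AB : A `<=` B by move=> n [k /andP[klo khi]]; exists k; rewrite klo ltW.
have [[n0 Bn0 An0]|BA] := pselect (exists2 n0, B n0 & ~ A n0); last first.
  have -> : B = A.
    by apply/seteqP; split=> // n Bn; apply: contrapT => An; apply: BA; exists n.
  by exists phi; split=> // n /phi_near; rewrite !ler_norml; lra.
have edge n : B n -> ~ A n -> exists k : int, n%:~R * alpha - k%:~R = lo + L.
  move=> [k /andP[klo khi]] An; exists k; apply/eqP; rewrite eq_le khi leNgt.
  by apply/negP => nk; apply: An; exists k; rewrite klo.
have BE : B = A `|` [set n0].
  apply/seteqP; split=> n; last by case=> [/AB|->].
  move=> Bn; have [An|An] := pselect (A n); [by left|right].
  have [k nk] := edge n Bn An; have [k0 nk0] := edge n0 Bn0 An0.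
  apply/eqP; rewrite -subr_eq0; apply/eqP; apply: (irrational_mulr_int (p := k - k0) alphaI).
  by rewrite !intrB; lra.
(* The extra point is inserted where the linear approximation predicts it. *)
pose j0 := Num.floor (n0%:~R * L - s0); rewrite BE.
eexists; split; first exact: (set_bij_insert j0 An0 phi_bij).
move=> n [/phi_near phin|->]; last first.
  by rewrite eqxx; have := floor_itv (n0%:~R * L - s0); rewrite -/j0 intrD ler_norml; lra.
case: eqP => [->|_].
  by have := floor_itv (n0%:~R * L - s0); rewrite -/j0 intrD ler_norml; lra.
by move: phin; case: ifP; rewrite ?intrD !ler_norml; lra.
Qed.

End Row.

Lemma euclidean_norm_le (R : realType) k (v : 'rV[R]_k) :
  euclidean_norm v <= \sum_(i < k) `|v 0 i|.
Proof.
have S0 : 0 <= \sum_(i < k) `|v 0 i| by exact: sumr_ge0.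
rewrite -[leRHS]ger0_norm// -sqrtr_sqr; apply: ler_wsqrtr.
rewrite expr2 mulr_suml; apply: ler_sum => i _.
rewrite -real_normK ?num_real// expr2 ler_wpM2l//.
by rewrite (bigD1 i)//= lerDl sumr_ge0.
Qed.

(** * V as a graph over its first d coordinates *)

Section Graph.
Context {R : realType} {d : nat} (a : 'I_d -> R).
Implicit Types (y : 'I_d -> R) (v w : 'rV[R]_d.+1).

Definition graph_point y : 'rV[R]_d.+1 :=
  \row_j if unlift ord_max j is Some i then y i else \sum_(i < d) y i * a i.

Lemma graph_point_lift y i : graph_point y 0 (lift ord_max i) = y i.
Proof. by rewrite mxE liftK. Qed.

Lemma graph_point_max y : graph_point y 0 ord_max = \sum_(i < d) y i * a i.
Proof. by rewrite mxE unlift_none. Qed.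

(** This reduces the final estimate to one coordinate at a time, at the price of a factor depending
    only on the slopes of V. *)
Lemma euclidean_norm_graph_point y (M : R) : (forall i, `|y i| <= M) ->
  euclidean_norm (graph_point y) <= M * \sum_(i < d) (1 + `|a i|).
Proof.
move=> yM; apply: le_trans (euclidean_norm_le _) _.
rewrite (bigD1_ord ord_max)//= graph_point_max.
under eq_bigr do rewrite graph_point_lift.
apply: (@le_trans _ _ (\sum_(i < d) `|y i * a i| + \sum_(i < d) `|y i|)).
  by rewrite lerD2r ler_norm_sum.
rewrite mulr_sumr -big_split; apply: ler_sum => i _ /=.
rewrite mulrDr mulr1 addrC lerD// normrM.
by apply: ler_wpM2r.
Qed.

Variable (V : {vspace 'rV[R]_d.+1}).
Hypothesis (ha : slopes V a).

Lemma mem_graph v :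
  (v \in V) = (v 0 ord_max == \sum_(i < d) v 0 (lift ord_max i) * a i).
Proof.
have Vv : [set` V] v = (v 0 ord_max = \sum_(i < d) v 0 (lift ord_max i) * a i).
  by rewrite ha.
by apply/idP/eqP; [rewrite -Vv|move=> ?; suff: [set` V] v by []; rewrite Vv].
Qed.

Lemma graph_pointP y : graph_point y \in V.
Proof.
by rewrite mem_graph graph_point_max; under [eqbRHS]eq_bigr do rewrite graph_point_lift.
Qed.

Lemma graph_pointE v : v \in V -> v = graph_point (fun i => v 0 (lift ord_max i)).
Proof.
rewrite mem_graph => /eqP vE; apply/rowP => j.
by case: (unliftP ord_max j) => [i|] ->; rewrite ?graph_point_lift ?graph_point_max.
Qed.

(** The rescaled coordinate vectors span V because each [rho i] is invertible, and their number is
    the dimension. The casts along [hdim] serve only the index type ['I_(\dim V)] of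
    [is_lattice]. *)
Lemma is_lattice_graph (rho : 'I_d -> R) :
  \dim V = d -> (forall i, rho i != 0) ->
  is_lattice V (range (fun c : 'I_d -> int =>
    graph_point (fun i => rho i * (c i)%:~R))).
Proof.
move=> hdim rho0.
pose e (i : 'I_d) := graph_point (fun j => if j == i then rho i else 0).
have eE (c : 'I_d -> R) : \sum_(i < d) c i *: e i = graph_point (fun i => rho i * c i).
  apply/rowP => j; rewrite summxE.
  case: (unliftP ord_max j) => [l|] ->.
    rewrite graph_point_lift (bigD1 l)//= mxE graph_point_lift eqxx mulrC big1 ?addr0//.
    by move=> i il; rewrite mxE graph_point_lift eq_sym (negPf il) mulr0.
  rewrite graph_point_max; apply: eq_bigr => i _.
  rewrite mxE graph_point_max (bigD1 i)//= eqxx big1 ?addr0; first by ring.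
  by move=> l li; rewrite (negPf li) mul0r.
pose b := [tuple e (cast_ord hdim i) | i < \dim V].
have bE (c : 'I_d -> R) : \sum_(i < \dim V) c (cast_ord hdim i) *: tnth b i =
    graph_point (fun i => rho i * c i).
  rewrite -eE [RHS](reindex (cast_ord hdim)) /=.
    by apply: eq_bigr => i _; rewrite tnth_mktuple.
  by exists (cast_ord (esym hdim)) => i _; rewrite ?cast_ordK ?cast_ordKV.
exists b.
  rewrite basisEdim size_tuple leqnn andbT; apply/subvP => v vV.
  rewrite (graph_pointE vV).
  have -> : graph_point (fun i => v 0 (lift ord_max i)) =
      graph_point (fun i => rho i * ((rho i)^-1 * v 0 (lift ord_max i))).
    by congr graph_point; apply/funext => i; rewrite mulVKf.
  rewrite -bE; apply: rpred_sum => i _; apply: rpredZ.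
  by apply: memv_span; exact: mem_tnth.
apply/seteqP; split=> _ [c _ <-].
  exists (c \o cast_ord hdim) => //.
  by rewrite -(bE (fun i => (c i)%:~R)).
exists (c \o cast_ord (esym hdim)) => //; rewrite -(bE (fun i => (_ i)%:~R)).
by apply: eq_bigr => i _; rewrite /= cast_ordK.
Qed.

Lemma line_windowP (I : set (circle R)) w :
  line_window I (\pi_(torus R d.+1) w) <->
  (forall i, w 0 (lift ord_max i) \is a Num.int) /\
  I (\pi_(circle R) (w 0 ord_max)).
Proof.
split=> [[t It /eqmodP]|[wZ Iw]].
  rewrite /= Quotient.equivE => /mxOverP wt; split=> [i|].
    have := wt 0 (lift ord_max i); rewrite !mxE eq_sym (negPf (neq_lift _ _)).
    by rewrite andbF mulr0 sub0r rpredN.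
  have := wt 0 ord_max; rewrite !mxE !eqxx mulr1 => /intrP[p tp].
  suff -> : \pi_(circle R) (w 0 ord_max) = \pi_(circle R) t by [].
  by apply/pi_circleP; exists (- p); rewrite intrN -tp; ring.
exists (w 0 ord_max) => //; apply/eqmodP; rewrite /= Quotient.equivE.
apply/mxOverP => i j; rewrite (ord1 i) !mxE eqxx /=.
case: (unliftP ord_max j) => [l|] ->; last by rewrite eqxx mulr1 subrr rpred0.
by rewrite eq_sym (negPf (neq_lift _ _)) mulr0 sub0r rpredN.
Qed.

End Graph.

(** * Assembly of the rows into a lattice *)

Theorem theorem1p1 (R : realType) (d : nat) (hd : (1 <= d)%N)
    (V : {vspace 'rV[R]_d.+1}) (hdim : \dim V = d)
    (hV : totally_irrational V)
    (hlast : last_basis_vector \notin V)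
    (a : 'I_d -> R) (ha : slopes V a)
    (hirr : irrational (a (Ordinal hd))) :
  exists2 K : R, 0 < K &
    forall (x : 'rV[R]_d.+1) (I : set (circle R)),
      special_interval (frac_part (a (Ordinal hd))) I ->
      exists (L : set 'rV[R]_d.+1) (f : 'rV[R]_d.+1 -> 'rV[R]_d.+1),
        [/\ is_lattice V L,
            set_bij (cut_and_project V (line_window I) x) L f
          & (ereal_sup [set (euclidean_norm (f y - y))%:E
                         | y in cut_and_project V (line_window I) x]
             <= (K * (window_length I)^-1)%:E)%E].
Proof.
set i0 := Ordinal hd in hirr *.
pose S := \sum_(i < d) (1 + `|a i|).
have S0 : 0 < S.
  by rewrite /S (bigD1 i0)//= ltr_pwDl// sumr_ge0.
(* 8 = 4 * 2: the bound of [closed_row], times the factor lost in passing from [L] to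
   [window_length I]. *)
exists (8 * S); first by rewrite mulr_gt0.
move=> x I specI.
have [q [p [q' [p' [g [L [LE det [L01 qL] g01 IE]]]]]]] := special_interval_arc hirr specI.
have /andP[wl0 wlL] := window_length_bounds g01 L01 IE.
have /andP[L0 L1] := L01.
pose xi (i : 'I_d) := x 0 (lift ord_max i).
(* One enumeration is chosen for each offset [r], so points of the same row share it. The shift
   [xi i0 * L] makes [psi r n / L] approximate the coordinate n - [xi i0] itself. *)
have [psi psiP] := choice (fun r => closed_row hirr LE det L01 qL (g - r) (xi i0 * L)).
pose n (v : 'rV[R]_d.+1) (i : 'I_d) := Num.floor (v 0 (lift ord_max i) + xi i).
pose rest (m : 'I_d -> int) : R := \sum_(i < d | i != i0) (m i)%:~R * a i
  + x 0 ord_max - \sum_(i < d) xi i * a i.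
(* Away from [i0] the coordinate of [v] is an integer minus [xi i], so replacing [xi i] by its floor
   moves it by less than 1. *)
pose c v (i : 'I_d) := if i == i0 then psi (rest (n v)) (n v i0) else n v i - Num.floor (xi i).
pose rho (i : 'I_d) := if i == i0 then L^-1 else 1.
pose P r (m : int) := exists k : int, g - r <= m%:~R * a i0 - k%:~R <= g - r + L.
have lastE (v : 'rV[R]_d.+1) (m : 'I_d -> int) :
    (forall i, v 0 (lift ord_max i) + xi i = (m i)%:~R) -> v \in V ->
    v 0 ord_max + x 0 ord_max = (m i0)%:~R * a i0 + rest m.
  move=> vm; rewrite (mem_graph ha) => /eqP ->; rewrite /rest.
  have -> : \sum_(i < d) v 0 (lift ord_max i) * a i =
      \sum_(i < d) (m i)%:~R * a i - \sum_(i < d) xi i * a i.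
    by rewrite -sumrB; apply: eq_bigr => i _; rewrite -vm; ring.
  by rewrite (bigD1 i0)//=; ring.
have YP (v : 'rV[R]_d.+1) (m : 'I_d -> int) :
    (forall i, v 0 (lift ord_max i) + xi i = (m i)%:~R) -> v \in V ->
    I (\pi_(circle R) (v 0 ord_max + x 0 ord_max)) <-> P (rest m) (m i0).
  move=> vm vV; rewrite (lastE _ _ vm vV) IE /P.
  by split=> -[k ?]; exists k; lra.
have Yint v : cut_and_project V (line_window I) x v ->
    v \in V /\ forall i, v 0 (lift ord_max i) + xi i = (n v i)%:~R.
  move=> [vV /line_windowP[vZ _]]; split=> // i.
  by have := vZ i; rewrite mxE => vi; rewrite /n floorK.
have YP' v : cut_and_project V (line_window I) x v -> P (rest (n v)) (n v i0).
  move=> Yv; have [vV vn] := Yint _ Yv; apply/(YP _ _ vn vV).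
  by case: Yv => _ /line_windowP[_]; rewrite mxE.
exists (range (fun c : 'I_d -> int => graph_point a (fun i => rho i * (c i)%:~R))).
exists (fun v => graph_point a (fun i => rho i * (c v i)%:~R)); split.
- apply: is_lattice_graph => // i; rewrite /rho; case: ifP => _; last exact: oner_neq0.
  by rewrite invr_eq0 gt_eqF.
- split=> [v _|v w|_ [m _ <-]].
  + by exists (c v).
  + rewrite !inE => Yv Yw cvw.
    have [vV vn] := Yint _ Yv; have [wV wn] := Yint _ Yw.
    have cE i : c v i = c w i.
      have := congr1 (fun u : 'rV[R]_d.+1 => u 0 (lift ord_max i)) cvw.
      rewrite !graph_point_lift => /mulfI e; apply: (@intr_inj R); apply: e.
      by rewrite /rho; case: ifP => _; rewrite ?oner_neq0// invr_eq0 gt_eqF.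
    (* Agreement off [i0] puts the two points on the same row, where [psi] is injective. *)
    have nE i : i != i0 -> n v i = n w i.
      by move=> ii0; have := cE i; rewrite /c (negPf ii0) => /addIr.
    have restE : rest (n v) = rest (n w).
      by congr (_ + _ - _); apply: eq_bigr => i /nE ->.
    have n0 : n v i0 = n w i0.
      have := cE i0; rewrite /c eqxx restE; have [[_ + _] _] := psiP (rest (n w)).
      by apply; rewrite inE; [rewrite -restE|]; exact: YP'.
    rewrite (graph_pointE ha vV) (graph_pointE ha wV); congr graph_point; apply/funext => i.
    apply: (@addIr _ (xi i)); rewrite vn wn.
    by have [->|/nE ->] := eqVneq i i0; rewrite ?n0.
  + pose m' i := m i + Num.floor (xi i).
    (* [rest] ignores the entry at [i0], so the row is known before its entry [k0] is found by
       surjectivity of [psi]. *)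
    have [[_ _ /(_ (m i0) Logic.I)[k0 Pk0 k0E]] _] := psiP (rest m').
    pose l i := if i == i0 then k0 else m' i.
    have restE : rest l = rest m'.
      by congr (_ + _ - _); apply: eq_bigr => i ii0; rewrite /l (negPf ii0).
    pose v := graph_point a (fun i => (l i)%:~R - xi i).
    have vl i : v 0 (lift ord_max i) + xi i = (l i)%:~R by rewrite graph_point_lift subrK.
    have nl i : n v i = l i by rewrite /n vl intrKfloor.
    have vV : v \in V by exact: graph_pointP.
    exists v.
      split=> //; apply/line_windowP; split=> [i|].
        by rewrite mxE vl intr_int.
      by rewrite mxE; apply/(YP _ _ vl vV); rewrite restE /l eqxx.
    congr graph_point; apply/funext => i; congr (_ * _%:~R).
    rewrite /c; case: eqP => [->|/eqP ii0]; last by rewrite nl /l (negPf ii0) addrK.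
    by rewrite nl (_ : n v = l) ?restE ?/l ?eqxx//; apply/funext.
- apply: ge_ereal_sup => _ [v Yv <-]; rewrite lee_fin.
  have [vV vn] := Yint _ Yv; have Pv := YP' _ Yv.
  have -> : graph_point a (fun i => rho i * (c v i)%:~R) - v =
      graph_point a (fun i => rho i * (c v i)%:~R - v 0 (lift ord_max i)).
    rewrite {2}(graph_pointE ha vV); apply/rowP => j; rewrite !mxE.
    case: unliftP => [//|_]; rewrite -sumrB; apply: eq_bigr => i _; ring.
  apply: (@le_trans _ _ (4 / L * S)).
    apply: euclidean_norm_graph_point => i.
    have vE : v 0 (lift ord_max i) = (n v i)%:~R - xi i by rewrite -vn addrK.
    rewrite vE /rho /c; case: eqP => [->|_].
      have [_ /(_ _ Pv)] := psiP (rest (n v)) => near.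
      rewrite ler_pdivlMr// -{2}[L]gtr0_norm// -normrM -normrN.
      apply: le_trans near; rewrite le_eqVlt; apply/orP; left; apply/eqP.
      by congr (`|_|); field; rewrite gt_eqF.
    have := floor_itv (xi i); rewrite intrD => xif.
    (* In the other directions the error is at most 1, which is below 4 / L because L <= 1. *)
    apply: (@le_trans _ _ 1); last by rewrite ler_pdivlMr// mul1r; lra.
    by rewrite intrB ler_norml; lra.
  have : L^-1 <= 2 / window_length I.
    by rewrite ler_pdivlMr// -ler_pdivlMl ?invr_gt0// invrK; lra.
  nra.
Qed.
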